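(* Let $v=(0,1,0,0,0,0,0,1)$ and $\eta=(3,1)$, so that $k=10$. Let $H_1,H_2,H_3$ be the tournaments defined as follows, each with its vertices ordered by increasing lower index $j$ of $v^i_j$ and given by its set of backward edges under this ordering: $H_1$: vertices $v^1_2,v^1_3,v^1_4,v^1_7,v^1_8,v^1_9,v^1_{10}$, backward edges $(v^1_9,v^1_7),(v^1_9,v^1_4),(v^1_7,v^1_2),(v^1_{10},v^1_8)$; $H_2$: vertices $v^2_1,v^2_2,v^2_6,v^2_7,v^2_8,v^2_9,v^2_{10}$, backward edges $(v^2_6,v^2_1),(v^2_9,v^2_7),(v^2_9,v^2_2),(v^2_7,v^2_2),(v^2_{10},v^2_8)$; $H_3$: vertices $v^3_3,v^3_4,v^3_5,v^3_7,v^3_8,v^3_9,v^3_{10}$, backward edges $(v^3_5,v^3_3),(v^3_9,v^3_4),(v^3_9,v^3_7),(v^3_7,v^3_4),(v^3_{10},v^3_8)$. Let $\mathcal{F}=\{f_1,f_2,f_3\}$ with $f_i:V(H_i)\to\{1,\dots,10\}$, $f_i(v^i_j)=j$. Then $\mathcal{H}=\{H_1,H_2,H_3\}$ has the $(\mathcal{F},v,\eta)$-strong EH-property.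
   Context: Given an ordering of the vertices of a tournament, an edge $(x,y)$ is backward if $y$ precedes $x$; a tournament on an ordered vertex set is determined by its backward edges (all other edges go from earlier to later vertices). Tournaments are finite; transitive = no directed cycle; $tr(T)$ = maximum size of a transitive subtournament of $T$. $V_1$ is complete to $V_2$ if every vertex of $V_1$ has an edge to every vertex of $V_2$. For disjoint nonempty $X,Y$, $d(X,Y)=e_{X,Y}/(|X||Y|)$, $e_{X,Y}$ = number of edges $(x,y)$ with $x\in X,y\in Y$. $\zeta^v(i)=|\{j\le i:v(j)=1\}|$. For a tournament $T$, $c>0$, $0\le\lambda<1$, a $(v,\eta,c,\lambda)$-m-sequence in $T$ is a sequence $\chi=(S_1,\dots,S_m)$ of pairwise disjoint subsets of $V(T)$ ($m$ the length of $v$) such that: if $v(i)=1$, $S_i$ induces a transitive subtournament partitioned into $S_{i,1},\dots,S_{i,\eta(\zeta^v(i))}$ with $S_{i,a}$ complete to $S_{i,b}$ for $a<b$ and $|S_{i,a}|\ge c\,tr(T)$; if $v(i)=0$, $|S_i|\ge c|T|$; $d(S_i,S_j)\ge1-\lambda$ for $i<j$. Its long representation $l(\chi)=(T_1,\dots,T_k)$ replaces each $S_i$ with $v(i)=1$ by $S_{i,1},\dots,S_{i,\eta(\zeta^v(i))}$ in order; $V(\chi)=\bigcup S_i$. A $c'$-strong pair in $\chi$ is a pair $(A,B)$ of disjoint subsets of $V(\chi)$ with $|A|\ge c'|T|$, either $|B|\ge c'|T|$ or ($B$ transitive and $|B|\ge c'\,tr(T)$), and $d(A,B)=1$ or $d(B,A)=1$.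 A finite family $\mathcal{H}=\{H_1,\dots,H_t\}$ with injective $f_i:V(H_i)\to\{1,\dots,k\}$, $\mathcal{F}=\{f_1,\dots,f_t\}$, has the $(\mathcal{F},v,\eta)$-strong EH-property if for every $c_1>0$ there exist $\lambda_0>0,c_2>0$ such that for every tournament $T$, $0\le\lambda\le\lambda_0$ and $(v,\eta,c_1,\lambda)$-m-sequence $\chi$ in $T$ with $l(\chi)=(T_1,\dots,T_k)$, either there exist $i$ and an injective map $x:V(H_i)\to V(T)$ with $x(h)\in T_{f_i(h)}$ for every $h$ which is an isomorphism of $H_i$ onto the subtournament of $T$ induced on its image, or $\chi$ contains a $c_2$-strong pair. *)

(* Defs.v *)
From mathcomp Require Import all_boot all_order all_algebra.
From mathcomp Require Import boolp reals.
Set Implicit Arguments.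
Unset Strict Implicit.
Unset Printing Implicit Defensive.
Import Order.TTheory GRing.Theory Num.Theory.

Record tournament := Tournament {
  vertex :> finType;
  edge : rel vertex;
  edge_irr : irreflexive edge;
  edge_total : forall x y, x != y -> edge x y (+) edge y x
}.

Section TournamentNotions.
Variable T : tournament.
Implicit Types A B X Y : {set T}.

Definition transitive_set A :=
  forall s : seq T, s != [::] -> uniq s -> {subset s <= A} ->
    ~ cycle (@edge T) s.

Definition tr : nat := \max_(A : {set T} | `[< transitive_set A >]) #|A|.

Definition complete_to X Y := {in X & Y, forall x y, edge x y}.

Definition edge_count X Y : nat := #|[set p in setX X Y | edge p.1 p.2]|.

(* Since 0 / 0 = 0, a density bounded below by a positive number forces both
   sets to be nonempty, as the usual definition of the density requires. *)
Definition density (R : realType) X Y : R :=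
  ((edge_count X Y)%:R / (#|X| * #|Y|)%:R)%R.

End TournamentNotions.

Section MSequences.

(* A 0/1 vector is a [seq bool], and (eta(1), eta(2), ...) is a [seq nat].
   Positions of v are counted from 0, so the entry usually written v(i+1) is
   [nth false v i] and eta(r) is [nth 0 eta r.-1]; the argument of [zeta] is
   the usual one, counted from 1. *)
Definition zeta (v : seq bool) (i : nat) : nat := count id (take i v).

Definition eta_at (v : seq bool) (eta : seq nat) (i : nat) : nat :=
  nth 0 eta (zeta v i.+1).-1.

(* The number k of terms of a long representation. *)
Definition long_size (v : seq bool) (eta : seq nat) : nat :=
  sumn (mkseq (fun i => if nth false v i then eta_at v eta i else 1) (size v)).

(* The chosen subdivisions of the transitive terms are part of the data, because
   the long representation depends on them;
   [mseq_block chi i] is only meaningful when the i-th entry of v is 1. *)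
Record msequence (T : tournament) (m : nat) := MSequence {
  mseq_term :> 'I_m -> {set T};
  mseq_block : 'I_m -> seq {set T}
}.

Definition mseq_support T m (chi : msequence T m) : {set T} := \bigcup_i chi i.

Definition long_repr T (v : seq bool) (chi : msequence T (size v)) :
    seq {set T} :=
  flatten [seq if nth false v i then mseq_block chi i else [:: chi i]
          | i : 'I_(size v)].

Local Open Scope ring_scope.

Record is_msequence (R : realType) (T : tournament) (v : seq bool)
    (eta : seq nat) (c lambda : R) (chi : msequence T (size v)) : Prop := {
  mseq_c : 0 < c;
  mseq_lambda : 0 <= lambda < 1;
  mseq_disjoint : forall i j : 'I_(size v), i != j -> [disjoint chi i & chi j];
  mseq_transitive : forall i : 'I_(size v), nth false v i ->
    transitive_set (chi i);
  mseq_block_size : forall i : 'I_(size v), nth false v i ->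
    size (mseq_block chi i) = eta_at v eta i;
  mseq_partition : forall i : 'I_(size v), nth false v i ->
    uniq (mseq_block chi i) /\ partition [set:: mseq_block chi i] (chi i);
  mseq_complete : forall i : 'I_(size v), nth false v i ->
    forall a b : nat, (a < b < size (mseq_block chi i))%N ->
      complete_to (nth set0 (mseq_block chi i) a)
                  (nth set0 (mseq_block chi i) b);
  mseq_block_card : forall i : 'I_(size v), nth false v i ->
    forall B, B \in mseq_block chi i -> c * (tr T)%:R <= #|B|%:R;
  mseq_linear : forall i : 'I_(size v), ~~ nth false v i ->
    c * #|T|%:R <= #|chi i|%:R;
  mseq_density : forall i j : 'I_(size v), (i < j)%N ->
    1 - lambda <= density R (chi i) (chi j)
}.

Definition strong_pair (R : realType) T m (chi : msequence T m) (c : R)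
    (A B : {set T}) : Prop :=
  [/\ A \subset mseq_support chi, B \subset mseq_support chi
    & [disjoint A & B]] /\
  [/\ c * #|T|%:R <= #|A|%:R,
      c * #|T|%:R <= #|B|%:R \/ transitive_set B /\ c * (tr T)%:R <= #|B|%:R
    & density R A B = 1 \/ density R B A = 1].

End MSequences.

(* A tournament H together with an injection f : V(H) -> {1, ..., k}. *)
Record positioned (k : nat) := Positioned {
  pos_tournament :> tournament;
  label : pos_tournament -> nat;
  pos_inj : injective label;
  pos_range : forall h, 0 < label h <= k
}.

Definition strong_EH_property (R : realType) (v : seq bool) (eta : seq nat)
    (t : nat) (HF : 'I_t -> positioned (long_size v eta)) : Prop :=
  forall c1 : R, (0 < c1)%R ->
  exists lambda0 c2 : R, [/\ (0 < lambda0)%R, (0 < c2)%R &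
    forall (T : tournament) (lambda : R) (chi : msequence T (size v)),
      (0 <= lambda <= lambda0)%R -> is_msequence eta c1 lambda chi ->
      (exists (i : 'I_t) (x : HF i -> T),
         [/\ injective x,
             forall h, x h \in nth set0 (long_repr chi) (label h).-1
           & forall g h, edge (x g) (x h) = edge g h])
      \/ (exists A B : {set T}, strong_pair chi c2 A B)].

Arguments strong_EH_property R v eta {t} HF.

(* The tournament whose vertices are the numbers listed in L, ordered as natural
   numbers, with E listing the backward edges (a, b), b < a. *)
Section BackwardEdges.
Variables (L : seq nat) (E : seq (nat * nat)).

Definition backward_edge : rel (seq_sub L) := fun x y =>
  if ssval x < ssval y then (ssval y, ssval x) \notin E
  else (ssval y < ssval x) && ((ssval x, ssval y) \in E).

Lemma backward_edge_irr : irreflexive backward_edge.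
Proof. by move=> x; rewrite /backward_edge ltnn. Qed.

Lemma backward_edge_total x y :
  x != y -> backward_edge x y (+) backward_edge y x.
Proof.
rewrite -val_eqE /= /backward_edge neq_ltn => /orP[] lt_xy;
by rewrite lt_xy ltnNge (ltnW lt_xy) /=; case: (_ \in E).
Qed.

Definition backward_tournament : tournament :=
  Tournament backward_edge_irr backward_edge_total.

Lemma backward_pos_inj : injective (fun h : backward_tournament => ssval h).
Proof. exact: val_inj. Qed.

Lemma backward_pos_range k (L_range : all (fun j => 0 < j <= k) L)
  (h : backward_tournament) : 0 < ssval h <= k.
Proof. exact: (allP L_range _ (ssvalP h)). Qed.

Definition backward_positioned k (L_range : all (fun j => 0 < j <= k) L) :
    positioned k :=
  Positioned backward_pos_inj (backward_pos_range L_range).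

End BackwardEdges.

Definition v0 : seq bool :=
  [:: false; true; false; false; false; false; false; true].
Definition eta0 : seq nat := [:: 3; 1].

Lemma long_size0 : long_size v0 eta0 = 10.
Proof. by []. Qed.

Definition HF1 : positioned (long_size v0 eta0) :=
  @backward_positioned [:: 2; 3; 4; 7; 8; 9; 10]
    [:: (9, 7); (9, 4); (7, 2); (10, 8)]
    (long_size v0 eta0) isT.
Definition HF2 : positioned (long_size v0 eta0) :=
  @backward_positioned [:: 1; 2; 6; 7; 8; 9; 10]
    [:: (6, 1); (9, 7); (9, 2); (7, 2); (10, 8)]
    (long_size v0 eta0) isT.
Definition HF3 : positioned (long_size v0 eta0) :=
  @backward_positioned [:: 3; 4; 5; 7; 8; 9; 10]
    [:: (5, 3); (9, 4); (9, 7); (7, 4); (10, 8)]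
    (long_size v0 eta0) isT.

Definition HF0 (i : 'I_3) : positioned (long_size v0 eta0) :=
  match val i with 0 => HF1 | 1 => HF2 | _ => HF3 end.

(* Main.v *)
(** Write T_1, ..., T_10 for the long representation, and discard from each block
    the few vertices having more than a small proportion of edges in the wrong
    direction towards some other term; by Markov's inequality this costs little.
    Without a strong pair, any two large sets in distinct blocks, one of them in
    a linear block, are joined by edges in both directions.  Hence most vertices
    of T_7 have an out-neighbour in T_2, most vertices of T_9 have one in T_4,
    and some edge x_9 -> x_7 joins two such vertices, with x_7 -> x_2 and
    x_9 -> x_4.  If x_9 -> x_2, the vertices x_2, x_7, x_9 extend to a copy of
    H_2; if x_7 -> x_4, the vertices x_4, x_7, x_9 extend to a copy of H_3;
    otherwise x_2, x_4, x_7, x_9 extend to a copy of H_1.  The missing vertices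
    are found greedily: the vertices of a block which are joined in the forward
    direction to all vertices chosen so far still form a large set, and the
    disjoint backward edges (x_6, x_1), (x_5, x_3) and (x_10, x_8) are found
    between two such sets. *)

Require Import Defs.
From mathcomp Require Import all_boot all_order all_algebra.
From mathcomp Require Import boolp reals.
From mathcomp Require Import zify lra.

Set Implicit Arguments.
Unset Strict Implicit.
Unset Printing Implicit Defensive.
Import Order.TTheory GRing.Theory Num.Theory.

(** * Copies of tournaments given by backward edges *)

Lemma edge_asym (T : tournament) (x y : T) : edge x y -> edge y x = false.
Proof.
have [->|neq_xy] := eqVneq x y; first by rewrite edge_irr.
by move=> xy; have := edge_total neq_xy; rewrite xy /=; case: (edge y x).
Qed.

Lemma edgeN (T : tournament) (x y : T) : x != y -> ~~ edge x y -> edge y x.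
Proof. by move=> neq_xy /negPf xy; have := edge_total neq_xy; rewrite xy. Qed.

(** Only pairs in increasing order are tested, since antisymmetry settles the reversed ones.
    Injectivity is then automatic: distinct vertices are joined by an edge, and a common image would
    carry a loop. *)
Lemma backward_embedding (L : seq nat) (E : seq (nat * nat)) (T : tournament)
    (f : nat -> T) :
    (forall p q, p \in L -> q \in L -> p < q ->
       if (q, p) \in E then edge (f q) (f p) else edge (f p) (f q)) ->
  injective (fun h : backward_tournament L E => f (ssval h)) /\
  forall g h : backward_tournament L E,
    edge (f (ssval g)) (f (ssval h)) = edge g h.
Proof.
move=> f_edge.
have f_iso (g h : backward_tournament L E) :
    edge (f (ssval g)) (f (ssval h)) = edge g h.
  rewrite [RHS]/(backward_edge E g h) /backward_edge.
  have [lt_gh|lt_hg|eq_gh] := ltngtP (ssval g) (ssval h).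
  - have := f_edge _ _ (ssvalP g) (ssvalP h) lt_gh.
    by case: ifP => _ // /edge_asym.
  - have := f_edge _ _ (ssvalP h) (ssvalP g) lt_hg.
    by case: ifP => _ // /edge_asym.
  - by rewrite eq_gh edge_irr.
split=> // g h eq_f; apply/eqP; apply: contraT => /edge_total.
by rewrite -!f_iso eq_f edge_irr.
Qed.

(** * Double counting of edges and Markov's inequality *)

Lemma card_setIdE (I : finType) (X : {set I}) (P : pred I) :
  #|[set x in X | P x]| = \sum_(x in X) P x.
Proof.
rewrite -sum1_card big_mkcond [RHS]big_mkcond; apply: eq_bigr => x _.
by rewrite inE; case: (x \in X) => //=; case: (P x).
Qed.

Lemma sum_card_swap (I J : finType) (r : I -> J -> bool) (X : {set I})
    (Y : {set J}) :
  \sum_(x in X) #|[set y in Y | r x y]| = \sum_(y in Y) #|[set x in X | r x y]|.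
Proof.
under eq_bigr do rewrite card_setIdE.
by rewrite exchange_big; apply: eq_bigr => y _; rewrite card_setIdE.
Qed.

Lemma edge_countE (T : tournament) (X Y : {set T}) :
  edge_count X Y = \sum_(x in X) #|[set y in Y | edge x y]|.
Proof.
under eq_bigr do rewrite card_setIdE.
rewrite /edge_count card_setIdE pair_big_dep /=; apply: eq_bigl => -[x y] /=.
by rewrite in_setX.
Qed.

(** For each [x] in [X], its out-neighbours and in-neighbours in [Y] partition [Y]. *)
Lemma edge_countD (T : tournament) (X Y : {set T}) : [disjoint X & Y] ->
  edge_count X Y + edge_count Y X = #|X| * #|Y|.
Proof.
move=> dXY; rewrite !edge_countE [X in _ + X]sum_card_swap -big_split /=.
rewrite -sum_nat_const; apply: eq_bigr => x xX.
rewrite -cardsUI [X in _ + X](_ : _ = 0) ?addn0; last first.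
  apply: eq_card0 => y; rewrite !inE; apply/negP => /andP[/andP[_ xy] /andP[_]].
  by rewrite edge_asym.
apply: eq_card => y; rewrite !inE -andb_orr; case yY: (y \in Y) => //=.
have /edge_total : x != y by apply: contraTneq yY => <-;
  rewrite (disjointFr dXY).
by case: (edge x y).
Qed.

Local Open Scope ring_scope.

(** An empty set would give density 0, because division by zero yields 0, against [lambda < 1]. *)
Lemma edge_count_back (R : realType) (T : tournament) (X Y : {set T})
    (lambda : R) :
  [disjoint X & Y] -> lambda < 1 -> 1 - lambda <= density R X Y ->
  [/\ (0 < #|X|)%N, (0 < #|Y|)%N
    & (edge_count Y X)%:R <= lambda * #|X|%:R * #|Y|%:R].
Proof.
move=> dXY lt_lambda1; rewrite /density.
have [/eqP|XY_gt0] := posnP (#|X| * #|Y|)%N.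
  by move/eqP->; rewrite invr0 mulr0; lra.
rewrite ler_pdivlMr ?ltr0n // -edge_countD // natrD.
have /andP[-> ->] : (0 < #|X|)%N && (0 < #|Y|)%N by rewrite -muln_gt0.
move=> le_dens; split=> //; rewrite -mulrA -natrM -edge_countD // natrD.
by move: le_dens; lra.
Qed.

(** Each counted [x] contributes more than [e * #|Y|] to the double sum; the positive factor [#|Y|]
    is then cancelled. *)
Lemma markov_card (R : realType) (I J : finType) (r : I -> J -> bool)
    (X : {set I}) (Y : {set J}) (lambda e : R) : (0 < #|Y|)%N ->
  (\sum_(x in X) #|[set y in Y | r x y]|)%:R <= lambda * #|X|%:R * #|Y|%:R ->
  e * #|[set x in X | e * #|Y|%:R < #|[set y in Y | r x y]|%:R]|%:R
    <= lambda * #|X|%:R.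
Proof.
move=> Y_gt0 le_sum; set B := [set x in X | _].
rewrite -(ler_pM2r (_ : 0 < #|Y|%:R)) ?ltr0n //; apply: le_trans le_sum.
rewrite natr_sum (bigID (mem B)) /= ler_wpDr ?sumr_ge0 //.
rewrite mulrAC mulr_natr -sumr_const.
rewrite [leRHS](eq_bigl (mem B)) => [|x]; last first.
  by rewrite andb_idl // [x \in B]inE => /andP[].
by apply: ler_sum => x; rewrite inE => /andP[_ /ltW].
Qed.

(* [i] and [j] are the positions of the sets of [x] and of [Y]. *)
Definition wrong (T : tournament) (i j : nat) (x : T) (Y : {set T}) : {set T} :=
  [set y in Y | if (i < j)%N then edge y x else edge x y].

(** * Atypical vertices of an m-sequence *)

Section Typical.
Variables (R : realType) (v : seq bool) (eta : seq nat) (T : tournament).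
Variables (c lambda : R) (chi : msequence T (size v)).
Hypothesis chi_mseq : is_msequence eta c lambda chi.
Variable e : R.
Hypothesis e_gt0 : 0 < e.

(** Wrong edges are counted towards whole terms, because densities are given only between terms; a
    bound on the wrong neighbours in a term also bounds those in each of its blocks. *)
Definition atypical (i : 'I_(size v)) : {set T} :=
  [set x in chi i
  | [exists j, (j != i) && (e * #|chi j|%:R < #|wrong i j x (chi j)|%:R)]].

(** Markov's inequality for each other term, then a union bound over the terms. *)
Lemma card_atypical i :
  e * #|atypical i|%:R <= (size v)%:R * lambda * #|chi i|%:R.
Proof.
have /andP[lambda_ge0 lt_lambda1] := mseq_lambda chi_mseq.
(* The conjunct [j != i] makes [B i] empty, so the union bound may run over all indices. *)
pose B j := [set x in chi i |
  (j != i) && (e * #|chi j|%:R < #|wrong i j x (chi j)|%:R)].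
have leB j : e * #|B j|%:R <= lambda * #|chi i|%:R.
  have [->|neq_ji] := eqVneq j i.
    rewrite (_ : B i = set0) ?cards0 ?mulr0 ?mulr_ge0 ?ler0n //.
    by apply/setP=> x; rewrite !inE eqxx andbF.
  have dij : [disjoint chi i & chi j].
    by apply: (mseq_disjoint chi_mseq); rewrite eq_sym.
  rewrite /B neq_ji /=; have [lt_ij|lt_ji|eq_ij] := ltngtP i j.
  - have [_ Xj le_ij] :=
      edge_count_back dij lt_lambda1 (mseq_density chi_mseq lt_ij).
    rewrite /wrong lt_ij; apply: markov_card => //.
    by rewrite sum_card_swap -edge_countE.
  - rewrite disjoint_sym in dij.
    have [Xj _ le_ij] :=
      edge_count_back dij lt_lambda1 (mseq_density chi_mseq lt_ji).
    rewrite /wrong ltnNge ltnW //; apply: markov_card => //.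
    by rewrite -edge_countE mulrAC.
  - by case/eqP: neq_ji; apply: val_inj.
have le_card : (#|atypical i| <= \sum_j #|B j|)%N.
  rewrite -sum1_card (eq_bigr (fun j => \sum_(x in B j) 1)%N); last first.
    by move=> j _; rewrite sum1_card.
  under [leqRHS]eq_bigr do rewrite big_mkcond.
  rewrite exchange_big big_mkcond /=; apply: leq_sum => x _.
  case: ifP => //; rewrite !inE => /andP[xi /existsP[j bad]].
  by rewrite (bigD1 j) //= !inE xi bad.
apply: (@le_trans _ _ (e * (\sum_j #|B j|)%:R)).
  by rewrite ler_pM2l // ler_nat.
rewrite natr_sum mulr_sumr.
apply: (@le_trans _ _ (\sum_(j < size v) lambda * #|chi i|%:R)).
  by apply: ler_sum => j _; apply: leB.
by rewrite sumr_const card_ord -[leLHS]mulr_natl mulrA.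
Qed.

End Typical.

(** Here [p] and [q] are positions in the long representation, whereas [wrong] compares positions of
    terms. *)
Definition forward (T : tournament) (p q : nat) (x y : T) : bool :=
  if (p < q)%N then edge x y else edge y x.

(** * Greedy embedding into ten large sets *)

Section GreedyEmbedding.
(** [G p] stands for $T_p$ without its atypical vertices, and [W p] for the scale of its size, $|T|$
    or $tr(T)$. *)
Variables (R : realType) (T : tournament) (G : nat -> {set T}) (W : nat -> R).
Variable c : R.
Hypotheses (c_gt0 : 0 < c) (W_gt0 : forall p, 0 < W p).

Let pos p := (0 < p <= 10)%N.
Let linear p := p \notin [:: 2; 3; 4; 10]%N.

Hypothesis G_large : forall p, pos p -> (c - c / 16) * W p <= #|G p|%:R.
Hypothesis G_typical : forall p q x, pos p -> pos q -> p != q -> x \in G p ->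
  #|[set y in G q | ~~ forward p q x y]|%:R <= c / 16 * W q.
Hypothesis G_complete : forall p q x y, (1 < p < q)%N -> (q < 5)%N ->
  x \in G p -> y \in G q -> edge x y.
Hypothesis no_strong_pair : forall p q (A B : {set T}),
  pos p -> pos q -> p != q -> linear p || linear q ->
  A \subset G p -> B \subset G q ->
  c / 4 * W p <= #|A|%:R -> c / 4 * W q <= #|B|%:R ->
  exists a b, [/\ a \in A, b \in B & edge a b].

Definition realizes (L : seq nat) (E : seq (nat * nat)) : Prop :=
  exists f : nat -> T, (forall p, p \in L -> f p \in G p) /\
    forall p q, p \in L -> q \in L -> (p < q)%N ->
      if (q, p) \in E then edge (f q) (f p) else edge (f p) (f q).

(** A pair [(p, x)] in [s] records that [x] has been chosen in [G p]. *)
Let placed q (s : seq (nat * T)) :=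
  all (fun a => [&& pos a.1, a.1 != q & a.2 \in G a.1]) s.
Let fits q (s : seq (nat * T)) (y : T) := all (fun a => forward a.1 q a.2 y) s.

(** Each chosen vertex excludes at most [c / 16 * W q] candidates, so at least 9/16 of [c * W q]
    remains, more than the quarter that [no_strong_pair] asks for. *)
Lemma card_fits q s : pos q -> placed q s -> (size s <= 6)%N ->
  c / 4 * W q <= #|[set y in G q | fits q s y]|%:R.
Proof.
move=> pos_q ps le6.
have le_card : #|G q|%:R <=
    #|[set y in G q | fits q s y]|%:R + (size s)%:R * (c / 16 * W q).
  elim: s ps {le6} => [|[p x] s IHs] /=.
    move=> _; rewrite mul0r addr0 ler_nat; apply: subset_leq_card.
    by apply/subsetP => y yq; rewrite inE yq.
  move=> /andP[/and3P[pos_p neq_pq xp] /IHs{}IHs].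
  have := G_typical pos_p pos_q neq_pq xp; set D := [set y in G q | _] => leD.
  have : (#|[set y in G q | fits q s y]| <=
      #|[set y in G q | fits q ((p, x) :: s) y]| + #|D|)%N.
    rewrite -cardsUI (leq_trans _ (leq_addr _ _)) ?subset_leq_card //.
    apply/subsetP => y; rewrite !inE /= => /andP[-> ->].
    by rewrite andbT orbN.
  by rewrite -(ler_nat R) natrD -natr1; lra.
have := G_large pos_q.
have : (size s)%:R * (c / 16 * W q) <= 6 * (c / 16 * W q).
  by rewrite ler_wpM2r ?ler_nat // ltW // mulr_gt0 ?divr_gt0.
have : 0 < c * W q by rewrite mulr_gt0.
by move: le_card; lra.
Qed.

Lemma pick_fits q s : pos q -> placed q s -> (size s <= 6)%N ->
  exists2 y, y \in G q & fits q s y.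
Proof.
move=> pos_q ps le6; have := card_fits pos_q ps le6.
have [->|/set0Pn[y]] := eqVneq [set y in G q | fits q s y] set0.
  have : 0 < c * W q by rewrite mulr_gt0.
  by rewrite cards0; lra.
by rewrite inE => /andP[yq fy]; exists y.
Qed.

(** Both new vertices are compared with [s] but not with each other, since the edge between them has
    to be backward. *)
Lemma pick_back p q s : (p < q)%N -> pos p -> pos q -> linear p || linear q ->
    placed p s -> placed q s -> (size s <= 6)%N ->
  exists x y, [/\ x \in G p, y \in G q, edge y x, fits p s x & fits q s y].
Proof.
move=> lt_pq pos_p pos_q lin_pq psp psq le6.
have neq_qp : q != p by rewrite gtn_eqF.
have lin_qp : linear q || linear p by rewrite orbC.
have sub r : [set y in G r | fits r s y] \subset G r.
  by apply/subsetP => y; rewrite inE => /andP[].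
have [y [x []]] := no_strong_pair pos_q pos_p neq_qp lin_qp (sub q) (sub p)
    (card_fits pos_q psq le6) (card_fits pos_p psp le6).
by rewrite !inE => /andP[? ?] /andP[? ?] ?; exists x, y.
Qed.

(** The vertices of [G p] outside this set send no edge to [G q]. If the set were too small, they
    would make up more than 15/16 - 1/4 of [c * W p], against [no_strong_pair]. *)
Lemma card_with_edge p q : pos p -> pos q -> p != q -> linear p ->
  c / 4 * W p <= #|[set x in G p | [exists y in G q, edge x y]]|%:R.
Proof.
move=> pos_p pos_q neq_pq lin_p; set A := [set x in G p | _].
have := G_large pos_p; have := G_large pos_q.
have : 0 < c * W p by rewrite mulr_gt0.
have : 0 < c * W q by rewrite mulr_gt0.
have subD : G p :\: A \subset G p by rewrite subsetDl.
have lin_pq : linear p || linear q by rewrite lin_p.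
rewrite -(cardsID A (G p)) natrD (setIidPr _); last first.
  by apply/subsetP => x; rewrite inE => /andP[].
move=> cWq cWp Gq GA; rewrite leNgt; apply/negP => ltA.
have [||x [y []]] :=
  no_strong_pair pos_p pos_q neq_pq lin_pq subD (subxx (G q)).
- by lra.
- by lra.
rewrite !inE => /andP[/negP xA xp] yq xy; case: xA; rewrite xp.
by apply/existsP; exists y; rewrite yq.
Qed.

(** With the embedding stored as a list, the edge conditions unfold to a finite Boolean conjunction.
    Entries at indices outside [L], such as index 0, are fillers. *)
Lemma realizes_seq (L : seq nat) (E : seq (nat * nat)) (d : T) (s : seq T) :
    all (fun p => nth d s p \in G p) L ->
    all (fun p => all (fun q => (p < q)%N ==>
      if (q, p) \in E then edge (nth d s q) (nth d s p)
      else edge (nth d s p) (nth d s q)) L) L ->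
  realizes L E.
Proof.
move=> /allP sG /allP sE; exists (nth d s); split=> // p q pL qL lt_pq.
by have /allP/(_ q qL)/implyP/(_ lt_pq) := sE p pL.
Qed.

Lemma realizes_some :
  [\/ realizes [:: 2; 3; 4; 7; 8; 9; 10]%N
        [:: (9, 7); (9, 4); (7, 2); (10, 8)]%N,
     realizes [:: 1; 2; 6; 7; 8; 9; 10]%N
        [:: (6, 1); (9, 7); (9, 2); (7, 2); (10, 8)]%N
   | realizes [:: 3; 4; 5; 7; 8; 9; 10]%N
        [:: (5, 3); (9, 4); (9, 7); (7, 4); (10, 8)]%N].
Proof.
have sub p q : [set x in G p | [exists y in G q, edge x y]] \subset G p.
  by apply/subsetP => y; rewrite inE => /andP[].
have [x9 [x7 []]] := @no_strong_pair 9 7 _ _ isT isT isT isT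
  (sub 9 4)%N (sub 7 2)%N
  (@card_with_edge 9 4 isT isT isT isT) (@card_with_edge 7 2 isT isT isT isT).
rewrite !inE => /andP[x9G /existsP[x4 /andP[x4G e94]]].
move=> /andP[x7G /existsP[x2 /andP[x2G e72]]] e97.
have e24 : edge x2 x4 by apply: G_complete x2G x4G.
have [e92|e29] := boolP (edge x9 x2).
(* The edges among [x2], [x7], [x9] are now all backward, as $H_2$ demands; [x4] is abandoned. In
   the next case [x4], [x7], [x9] behave likewise for $H_3$, and [x2] is abandoned. *)
- constructor 2; pose s := [:: (2, x2); (7, x7); (9, x9)]%N.
  have [||x1 [x6 [x1G x6G e61]]] := @pick_back 1 6 s isT isT isT isT _ _ isT;
    rewrite /= ?x2G ?x7G ?x9G //.
  rewrite /fits /forward /= => /and4P[e12 e17 e19 _] /and4P[e26 e67 e69 _].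
  pose r := [:: (1, x1); (6, x6)]%N ++ s.
  have [||x8 [x10 [x8G x10G e108]]] := @pick_back 8 10 r isT isT isT isT _ _ isT;
    rewrite /= ?x1G ?x6G ?x2G ?x7G ?x9G //.
  rewrite /fits /forward /= => /and5P[e18 e68 e28 e78 /andP[e89 _]].
  move=> /and5P[e110 e610 e210 e710 /andP[e910 _]].
  apply: (@realizes_seq _ _ x1 [:: x1; x1; x2; x1; x1; x1; x6; x7; x8; x9; x10]).
    by apply/and5P; split=> //; apply/and4P; split.
  rewrite /= e61 e97 e92 e72 e108 e12 e17 e19 e26 e67 e69 e18 e68 e28 e78 e89.
  by rewrite e110 e610 e210 e710 e910.
have [e74|e47] := boolP (edge x7 x4).
- constructor 3; pose s := [:: (4, x4); (7, x7); (9, x9)]%N.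
  have [||x3 [x5 [x3G x5G e53]]] := @pick_back 3 5 s isT isT isT isT _ _ isT;
    rewrite /= ?x4G ?x7G ?x9G //.
  rewrite /fits /forward /= => /and4P[e34 e37 e39 _] /and4P[e45 e57 e59 _].
  pose r := [:: (3, x3); (5, x5)]%N ++ s.
  have [||x8 [x10 [x8G x10G e108]]] := @pick_back 8 10 r isT isT isT isT _ _ isT;
    rewrite /= ?x3G ?x5G ?x4G ?x7G ?x9G //.
  rewrite /fits /forward /= => /and5P[e38 e58 e48 e78 /andP[e89 _]].
  move=> /and5P[e310 e510 e410 e710 /andP[e910 _]].
  apply: (@realizes_seq _ _ x3 [:: x3; x3; x3; x3; x4; x5; x3; x7; x8; x9; x10]).
    by apply/and5P; split=> //; apply/and4P; split.
  rewrite /= e53 e97 e94 e74 e108 e34 e37 e39 e45 e57 e59 e38 e58 e48 e78 e89.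
  by rewrite e310 e510 e410 e710 e910.
constructor 1.
(* Distinctness follows from known edges: [x9 = x2] would contradict the edge from [x7] to [x2], and
   [x7 = x4] the edge from [x2] to [x4]. *)
have {}e29 : edge x2 x9.
  by apply: edgeN e29; apply: contraTneq e97 => ->; rewrite edge_asym.
have {}e47 : edge x4 x7.
  by apply: edgeN e47; apply: contraTneq e72 => ->; rewrite edge_asym.
pose s := [:: (2, x2); (4, x4); (7, x7); (9, x9)]%N.
(* No backward edge of $H_1$ meets position 3, so one fitting vertex suffices. *)
have [|x3 x3G] := @pick_fits 3 s isT _ isT; rewrite /= ?x2G ?x4G ?x7G ?x9G //.
rewrite /fits /forward /= => /and5P[e23 e34 e37 e39 _].
pose r := (3, x3)%N :: s.
have [||x8 [x10 [x8G x10G e108]]] := @pick_back 8 10 r isT isT isT isT _ _ isT;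
  rewrite /= ?x3G ?x2G ?x4G ?x7G ?x9G //.
rewrite /fits /forward /= => /and5P[e38 e28 e48 e78 /andP[e89 _]].
move=> /and5P[e310 e210 e410 e710 /andP[e910 _]].
apply: (@realizes_seq _ _ x2 [:: x2; x2; x2; x3; x4; x2; x2; x7; x8; x9; x10]).
  by apply/and5P; split=> //; apply/and4P; split.
rewrite /= e23 e24 e72 e28 e29 e210 e34 e37 e38 e39 e310 e47 e48 e94 e410.
by rewrite e78 e97 e710 e89 e108 e910.
Qed.

End GreedyEmbedding.

(** * Density 1, and the positions of the ten blocks *)

Lemma transitive_setS (T : tournament) (A B : {set T}) :
  A \subset B -> transitive_set B -> transitive_set A.
Proof. by move=> /subsetP AB tB s s0 us sA; apply: tB => // x /sA /AB. Qed.

Lemma card_le_tr (T : tournament) (A : {set T}) :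
  transitive_set A -> (#|A| <= tr T)%N.
Proof. by move=> tA; apply: leq_bigmax_cond; apply/asboolP. Qed.

Lemma density_eq1 (R : realType) (T : tournament) (A B : {set T}) :
    [disjoint A & B] -> (0 < #|A|)%N -> (0 < #|B|)%N ->
    {in A & B, forall a b, ~~ edge b a} -> density R A B = 1.
Proof.
move=> dAB A_gt0 B_gt0 noBA.
have cBA : edge_count B A = 0%N.
  apply: eq_card0 => -[b a]; rewrite !inE /=.
  by apply/negP => /andP[/andP[bB aA]]; apply/negP; apply: noBA.
have cAB : edge_count A B = (#|A| * #|B|)%N.
  by rewrite -edge_countD // cBA addn0.
by rewrite /density cAB divff // pnatr_eq0 -lt0n muln_gt0 A_gt0.
Qed.

(* For 1 <= p <= 10, the set T_p is the block number [block_index p] of the term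
   number [term_index p], both counted from 0; the entry at p = 0 is junk. *)
Definition term_index (p : nat) : nat :=
  nth 0%N [:: 0; 0; 1; 1; 1; 2; 3; 4; 5; 6; 7]%N p.
Definition block_index (p : nat) : nat := nth 0%N [:: 0; 0; 0; 1; 2]%N p.
Definition term (p : nat) : 'I_(size v0) := @inord 7 (term_index p).

Lemma term_index_lt p : (term_index p < 8)%N.
Proof.
by rewrite /term_index; do 11?[case: p => [|p] //]; rewrite nth_default.
Qed.

Lemma val_term p : term p = term_index p :> nat.
Proof. by rewrite inordK ?term_index_lt. Qed.

(** A finite check by evaluation on [iota 1 10]. It matches [forward], which compares blocks, with
    [wrong], which compares terms. *)
Lemma term_index_ltn p q : (0 < p <= 10)%N -> (0 < q <= 10)%N ->
  term_index p != term_index q -> (p < q)%N = (term_index p < term_index q)%N.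
Proof.
rewrite -!(mem_iota 1 10) => pI qI neq.
have /allP/(_ p pI)/allP/(_ q qI)/implyP/(_ neq)/eqP // : all (fun p => all (fun q =>
  (term_index p != term_index q) ==>
  ((p < q)%N == (term_index p < term_index q)%N)) (iota 1 10)) (iota 1 10) by [].
Qed.

(** Only term number 1, counted from 0, has several blocks: $T_2$, $T_3$, $T_4$. *)
Lemma term_index_eq p q : (0 < p <= 10)%N -> (0 < q <= 10)%N -> p != q ->
  term_index p = term_index q -> (1 < p < 5)%N && (1 < q < 5)%N.
Proof.
rewrite -!(mem_iota 1 10) => pI qI neq /eqP eq_pq.
have /allP/(_ p pI)/allP/(_ q qI)/implyP/(_ neq)/implyP/(_ eq_pq) // :
  all (fun p => all (fun q => (p != q) ==> (term_index p == term_index q) ==>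
  (1 < p < 5)%N && (1 < q < 5)%N) (iota 1 10)) (iota 1 10) by [].
Qed.

(** * Typical blocks satisfy the hypotheses of the greedy embedding *)

Section TypicalBlocks.
Variables (R : realType) (T : tournament) (c lambda : R).
Variable chi : msequence T (size v0).
Hypothesis chi_mseq : is_msequence eta0 c lambda chi.

(** The scale for term [i] and its blocks; it becomes the [W] of the greedy embedding. *)
Let capacity (i : nat) : nat := if nth false v0 i then tr T else #|T|.

(** Indexing by [iota 0 8] and splitting the block lists by their sizes 3 and 1 lets [flatten]
    compute to ten explicit sets. *)
Lemma long_repr_nth p : (0 < p <= 10)%N ->
  nth set0 (long_repr chi) p.-1 =
    if nth false v0 (term p) then
      nth set0 (mseq_block chi (term p)) (block_index p)
    else chi (term p).
Proof.
move=> pos_p.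
have size_block i : (i < 8)%N -> nth false v0 i ->
    size (mseq_block chi (@inord 7 i)) = eta_at v0 eta0 i.
  by move=> lt_i vi; rewrite (mseq_block_size chi_mseq) ?inordK.
have -> : long_repr chi = flatten [seq if nth false v0 i then
    mseq_block chi (@inord 7 i) else [:: chi (@inord 7 i)] | i <- iota 0 8].
  rewrite /long_repr -(val_enum_ord 8) -map_comp; congr flatten.
  by apply: eq_map => i /=; rewrite inord_val.
have := size_block 1%N isT isT; have := size_block 7%N isT isT.
rewrite val_term /term /=.
case E7: (mseq_block chi (@inord 7 7)) => [|B10 [|? ?]] // _.
case E1: (mseq_block chi (@inord 7 1)) => [|B2 [|B3 [|B4 [|? ?]]]] // _.
by move: pos_p; do 11?[case: p => [|p] //=];
  rewrite /term_index /block_index /= ?E1 ?E7.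
Qed.

Lemma block_index_lt p : (0 < p <= 10)%N -> nth false v0 (term p) ->
  (block_index p < size (mseq_block chi (term p)))%N.
Proof.
move=> pos_p v_p; rewrite (mseq_block_size chi_mseq) //; move: v_p.
rewrite val_term /term_index /block_index.
by move: pos_p; do 11?[case: p => [|p] //=].
Qed.

Lemma long_repr_sub p : (0 < p <= 10)%N ->
  nth set0 (long_repr chi) p.-1 \subset chi (term p).
Proof.
move=> pos_p; rewrite long_repr_nth //; case: ifP => // v_p.
have [_ /and3P[/eqP <- _ _]] := mseq_partition chi_mseq v_p.
by apply: (bigcup_max _ _ (subxx _)); rewrite inE mem_nth ?block_index_lt.
Qed.

Lemma long_repr_card p : (0 < p <= 10)%N ->
  c * (capacity (term p))%:R <= #|nth set0 (long_repr chi) p.-1|%:R.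
Proof.
move=> pos_p; rewrite long_repr_nth // /capacity; case: ifP => v_p.
  by apply: (mseq_block_card chi_mseq v_p); rewrite mem_nth ?block_index_lt.
by apply: (mseq_linear chi_mseq); rewrite v_p.
Qed.

Lemma long_repr_complete p q : (1 < p < q)%N -> (q < 5)%N ->
  complete_to (nth set0 (long_repr chi) p.-1) (nth set0 (long_repr chi) q.-1).
Proof.
move=> /andP[gt1p lt_pq] lt_q5.
have pos_p : (0 < p <= 10)%N by lia.
have pos_q : (0 < q <= 10)%N by lia.
have vp : nth false v0 (term p).
  rewrite val_term; move: gt1p (ltn_trans lt_pq lt_q5).
  by clear; do 5?[case: p => [|p] //].
have tq : term q = term p.
  apply: val_inj; rewrite /= !val_term; move: gt1p lt_pq lt_q5.
  by clear; do 5?[case: p => [|p] //]; do 5?[case: q => [|q] //].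
rewrite !long_repr_nth // tq vp; apply: (mseq_complete chi_mseq vp).
rewrite -[term p]tq block_index_lt ?tq // andbT.
move: gt1p lt_pq lt_q5.
by clear; do 5?[case: p => [|p] //]; do 5?[case: q => [|q] //].
Qed.

Lemma card_term_le i : (#|chi i| <= capacity i)%N.
Proof.
rewrite /capacity; case: ifP => v_i; last exact: max_card.
exact/card_le_tr/(mseq_transitive chi_mseq).
Qed.

(** The capacity bounds the size of the term, which is nonempty because its density with some other
    term is positive. *)
Lemma capacity_gt0 p : (0 < capacity (term p))%N.
Proof.
apply: leq_trans (card_term_le _).
have /andP[_ lt_lambda1] := mseq_lambda chi_mseq.
have [j neq_j] : exists j, term p != j.
  exists (if term p == @inord 7 0 then @inord 7 1 else @inord 7 0).
  case: ifPn => // /eqP ->.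
  by rewrite -val_eqE /= !inordK.
have dij := mseq_disjoint chi_mseq neq_j.
have [lt_ij|lt_ji|eq_ij] := ltngtP (term p) j.
- by have [] := edge_count_back dij lt_lambda1 (mseq_density chi_mseq lt_ij).
- rewrite disjoint_sym in dij.
  by have [] := edge_count_back dij lt_lambda1 (mseq_density chi_mseq lt_ji).
- by case/eqP: neq_j; apply: val_inj.
Qed.

(** The 8 cancels the number of terms in [card_atypical]: at most [c / 16 * #|chi i|] vertices of
    [chi i] are then atypical. *)
Hypothesis lambda_le : lambda <= (c / 16) ^+ 2 / 8.

Let c_gt0 : 0 < c. Proof. exact: mseq_c chi_mseq. Qed.

Definition typical_block (p : nat) : {set T} :=
  nth set0 (long_repr chi) p.-1 :\: atypical chi (c / 16) (term p).

Lemma typical_sub p : typical_block p \subset nth set0 (long_repr chi) p.-1.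
Proof. exact: subsetDl. Qed.

Lemma typical_sub_term p : (0 < p <= 10)%N ->
  typical_block p \subset chi (term p).
Proof.
by move=> pos_p; apply: subset_trans (typical_sub p) (long_repr_sub pos_p).
Qed.

(** Within one term, completeness between blocks gives disjointness: a common vertex would carry a
    loop. *)
Lemma typical_disjoint p q : (0 < p <= 10)%N -> (0 < q <= 10)%N -> p != q ->
  [disjoint typical_block p & typical_block q].
Proof.
wlog lt_pq : p q / (p < q)%N => [IH pos_p pos_q neq_pq|pos_p pos_q neq_pq].
  have [lt_pq|lt_qp|eq_pq] := ltngtP p q; first exact: IH.
    by rewrite disjoint_sym; apply: IH; rewrite // eq_sym.
  by rewrite eq_pq eqxx in neq_pq.
have [eq_t|neq_t] := eqVneq (term_index p) (term_index q); last first.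
  have := typical_sub_term pos_p; have := typical_sub_term pos_q.
  move=> sq sp; apply: disjointWl sp _; apply: disjointWr sq _.
  by apply: (mseq_disjoint chi_mseq); rewrite -val_eqE /= !val_term.
have /andP[/andP[gt1p _] /andP[_ lt_q5]] :=
  term_index_eq pos_p pos_q neq_pq eq_t.
rewrite disjoint_subset; apply/subsetP => x /(subsetP (typical_sub p)) xp.
rewrite inE; apply/negP => /(subsetP (typical_sub q)) xq.
have := @long_repr_complete p q _ lt_q5 x x xp xq.
by rewrite gt1p edge_irr => /(_ lt_pq).
Qed.

Lemma typical_card p : (0 < p <= 10)%N ->
  (c - c / 16) * (capacity (term p))%:R <= #|typical_block p|%:R.
Proof.
move=> pos_p; have e_gt0 : 0 < c / 16 by rewrite divr_gt0.
have le_atyp : #|atypical chi (c / 16) (term p)|%:R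
    <= c / 16 * #|chi (term p)|%:R.
  rewrite -(ler_pM2l e_gt0); apply: le_trans (card_atypical chi_mseq e_gt0 _) _.
  rewrite mulrA ler_wpM2r // -expr2 (_ : size v0 = 8) //.
  by move: lambda_le; lra.
have le_cap : c / 16 * #|chi (term p)|%:R <= c / 16 * (capacity (term p))%:R.
  by rewrite ler_pM2l // ler_nat card_term_le.
have := long_repr_card pos_p.
rewrite -(cardsID (atypical chi (c / 16) (term p))) natrD.
have : #|nth set0 (long_repr chi) p.-1 :&: atypical chi (c / 16) (term p)|%:R
    <= #|atypical chi (c / 16) (term p)|%:R :> R.
  by rewrite ler_nat subset_leq_card // subsetIr.
by rewrite -/(typical_block p); lra.
Qed.

(** Blocks of one term admit no exception, by completeness. For different terms, every exception is
    a wrong neighbour, and too many of them would make [x] atypical. *)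
Lemma typical_forward p q x : (0 < p <= 10)%N -> (0 < q <= 10)%N -> p != q ->
    x \in typical_block p ->
  #|[set y in typical_block q | ~~ forward p q x y]|%:R
    <= c / 16 * (capacity (term q))%:R.
Proof.
move=> pos_p pos_q neq_pq xp; have e_gt0 : 0 < c / 16 by rewrite divr_gt0.
have [eq_t|neq_t] := eqVneq (term_index p) (term_index q).
  have /andP[/andP[gt1p lt_p5] /andP[gt1q lt_q5]] :=
    term_index_eq pos_p pos_q neq_pq eq_t.
  rewrite (_ : [set y in _ | _] = set0) ?cards0.
    by rewrite mulr_ge0 // ltW.
  apply/setP => y; rewrite in_set0 in_set; apply/negP => /andP[yq]; case/negP.
  have {}yq := subsetP (typical_sub q) _ yq.
  have {}xp := subsetP (typical_sub p) _ xp.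
  rewrite /forward; have [lt_pq|lt_qp|eq_pq] := ltngtP p q.
  - by apply: (long_repr_complete _ lt_q5 xp yq); rewrite gt1p.
  - by apply: (long_repr_complete _ lt_p5 yq xp); rewrite gt1q.
  - by rewrite eq_pq eqxx in neq_pq.
apply: (@le_trans _ _ (c / 16 * #|chi (term q)|%:R)); last first.
  by rewrite ler_pM2l // ler_nat card_term_le.
have /setDP[xL /negP xN] := xp.
rewrite leNgt; apply/negP => lt_wrong; apply: xN.
rewrite inE (subsetP (long_repr_sub pos_p)) //=.
apply/existsP; exists (term q); rewrite -val_eqE /= !val_term eq_sym neq_t /=.
apply: lt_le_trans lt_wrong _; rewrite ler_nat; apply: subset_leq_card.
apply/subsetP => y /setIdP[yq]; rewrite /wrong in_set.
rewrite (subsetP (typical_sub_term pos_q)) //= /forward.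
have neq_xy : x != y.
  apply: contraTneq yq => <-.
  by rewrite (disjointFr (typical_disjoint pos_p pos_q neq_pq)).
rewrite (term_index_ltn pos_p pos_q neq_t); case: ifP => _; apply: edgeN => //.
by rewrite eq_sym.
Qed.

(** The first set of a strong pair must be large compared with $|T|$, so the set in a linear block
    is put first. Either order is possible because density 1 is allowed in both directions. *)
Lemma strong_pair_of_no_edge p q (A B : {set T}) :
    (0 < p <= 10)%N -> (0 < q <= 10)%N -> p != q ->
    (p \notin [:: 2; 3; 4; 10]%N) || (q \notin [:: 2; 3; 4; 10]%N) ->
    A \subset typical_block p -> B \subset typical_block q ->
    c / 4 * (capacity (term p))%:R <= #|A|%:R ->
    c / 4 * (capacity (term q))%:R <= #|B|%:R ->
    {in A & B, forall a b, ~~ edge a b} ->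
  exists A B : {set T}, strong_pair chi (c / 4) A B.
Proof.
move=> pos_p pos_q neq_pq lin_pq Ap Bq cA cB noAB.
have card_gt0 r (D : {set T}) : c / 4 * (capacity (term r))%:R <= #|D|%:R ->
    (0 < #|D|)%N.
  by move=> cD; rewrite -(ltr0n R) (lt_le_trans _ cD) // mulr_gt0 ?divr_gt0 //
    ltr0n capacity_gt0.
have dAB : [disjoint A & B].
  exact: disjointWl Ap (disjointWr Bq (typical_disjoint pos_p pos_q neq_pq)).
have support r (D : {set T}) : (0 < r <= 10)%N -> D \subset typical_block r ->
    D \subset mseq_support chi.
  move=> pos_r Dr; apply: subset_trans Dr _.
  exact: subset_trans (typical_sub_term pos_r) (bigcup_sup _ _).
have v_linear r : (0 < r <= 10)%N ->
    (r \notin [:: 2; 3; 4; 10]%N) = ~~ nth false v0 (term r).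
  by rewrite val_term /term_index; do 11?[case: r => [|r] //].
have large r (D : {set T}) : (0 < r <= 10)%N -> D \subset typical_block r ->
    c / 4 * (capacity (term r))%:R <= #|D|%:R ->
    c / 4 * #|T|%:R <= #|D|%:R
      \/ transitive_set D /\ c / 4 * (tr T)%:R <= #|D|%:R.
  move=> pos_r Dr; rewrite /capacity; case: ifP => v_r; last by left.
  right; split=> //; apply: transitive_setS (mseq_transitive chi_mseq v_r).
  exact: subset_trans Dr (typical_sub_term pos_r).
have dBA : density R B A = 1.
  rewrite density_eq1 ?(card_gt0 _ _ cA) ?(card_gt0 _ _ cB) 1?disjoint_sym //.
  by move=> b a bB aA; apply: noAB.
have linear r (D : {set T}) : (0 < r <= 10)%N -> r \notin [:: 2; 3; 4; 10]%N ->
    c / 4 * (capacity (term r))%:R <= #|D|%:R -> c / 4 * #|T|%:R <= #|D|%:R.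
  by move=> pos_r; rewrite v_linear // /capacity => /negPf ->.
case/orP: lin_pq => lin.
- exists A, B; split; first by split; [apply: support Ap|apply: support Bq|].
  by split; [apply: linear cA|apply: large Bq cB|right].
- exists B, A; split; last by split; [apply: linear cB|apply: large Ap cA|left].
  by split; [apply: support Bq|apply: support Ap|rewrite disjoint_sym].
Qed.

Lemma realizes_or_strong_pair :
  [\/ realizes typical_block [:: 2; 3; 4; 7; 8; 9; 10]%N
        [:: (9, 7); (9, 4); (7, 2); (10, 8)]%N,
     realizes typical_block [:: 1; 2; 6; 7; 8; 9; 10]%N
        [:: (6, 1); (9, 7); (9, 2); (7, 2); (10, 8)]%N
   | realizes typical_block [:: 3; 4; 5; 7; 8; 9; 10]%N
        [:: (5, 3); (9, 4); (9, 7); (7, 4); (10, 8)]%N]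
  \/ exists A B : {set T}, strong_pair chi (c / 4) A B.
Proof.
have [pair|no_pair] := pselect (exists A B, strong_pair chi (c / 4) A B).
  by right.
left; apply: (@realizes_some R T _ (fun p => (capacity (term p))%:R) c) => //.
- by move=> p; rewrite ltr0n capacity_gt0.
- exact: typical_card.
- exact: typical_forward.
- move=> p q x y pq lt_q5 /(subsetP (typical_sub p)) xp.
  by move=> /(subsetP (typical_sub q)); apply: long_repr_complete xp.
move=> p q A B pos_p pos_q neq_pq lin Ap Bq cA cB.
have [[a aA [b bB ab]]|noAB] :=
    pselect (exists2 a, a \in A & exists2 b, b \in B & edge a b).
  by exists a, b.
case: no_pair; apply: (strong_pair_of_no_edge pos_p pos_q neq_pq lin
  Ap Bq cA cB).
by move=> a b aA bB; apply/negP => ab; case: noAB; exists a => //; exists b.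
Qed.

Lemma realizes_copy (L : seq nat) (E : seq (nat * nat)) :
    realizes typical_block L E ->
  exists x : backward_tournament L E -> T, [/\ injective x,
    forall h, x h \in nth set0 (long_repr chi) (ssval h).-1
  & forall g h : backward_tournament L E, edge (x g) (x h) = edge g h].
Proof.
move=> [f [fG fE]]; have [f_inj f_iso] := backward_embedding fE.
exists (fun h => f (ssval h)); split=> // h.
exact: subsetP (typical_sub _) _ (fG _ (ssvalP h)).
Qed.

End TypicalBlocks.

Theorem theorem21 (R : realType) :
  strong_EH_property R v0 eta0 HF0.
Proof.
(* [c / 4] is the threshold at which the greedy embedding asks for an edge between two sets. *)
move=> c c_gt0; exists ((c / 16) ^+ 2 / 8), (c / 4).
split; rewrite ?divr_gt0 ?exprn_gt0 ?divr_gt0 //.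
move=> T lambda chi /andP[_ lambda_le] chi_mseq.
have [copy|] := realizes_or_strong_pair chi_mseq lambda_le; last by right.
left; case: copy => /realizes_copy[x x_copy].
- by exists (@Ordinal 3 0 isT), x.
- by exists (@Ordinal 3 1 isT), x.
- by exists (@Ordinal 3 2 isT), x.
Qed.
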